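(* For every integer $n\geq 0$, the polynomial $J_{2n}(x)$ is bi-$\gamma$-positive. Thus $J_{2n}(x)$ is alternatingly increasing and unimodal.
   Context: For $k\in(0,1)$ let $\mathrm{sn}(u,k)$ be the Jacobian elliptic function, i.e. $x=\mathrm{sn}(u,k)$ is the inverse of $u=\int_0^x\frac{dt}{\sqrt{(1-t^2)(1-k^2t^2)}}$, and let $\mathrm{cn}(u,k)=\sqrt{1-\mathrm{sn}^2(u,k)}$ (the branch near $u=0$ with $\mathrm{cn}(0,k)=1$). The polynomials $J_{2n}(x)$, $n\geq 1$, are defined by the Taylor expansion $\mathrm{cn}(u,k)=1+\sum_{n\geq 1}(-1)^nJ_{2n}(k^2)\frac{u^{2n}}{(2n)!}$, and $J_0(x)=1$. For $n\geq 1$ one has $\deg J_{2n}(x)=n-1$. For example $J_2(x)=1$, $J_4(x)=1+4x$, $J_6(x)=1+44x+16x^2$, $J_8(x)=1+408x+912x^2+64x^3$. A polynomial $f(x)=\sum_{i=0}^m f_ix^i$ of degree $m$ with real coefficients is unimodal if there is an index $r$ with $f_0\leq\cdots\leq f_r\geq f_{r+1}\geq\cdots\geq f_m$. It is alternatingly increasing if $f_0\leq f_m\leq f_1\leq f_{m-1}\leq\cdots\leq f_{\lfloor (m+1)/2\rfloor}$. A polynomial $h(x)$ satisfying $h(x)=x^d h(1/x)$ can be uniquely expanded as $h(x)=\sum_{k=0}^{\lfloor d/2\rfloor}\gamma_kx^k(1+x)^{d-2k}$, and it is called $\gamma$-positive if all $\gamma_k\geq 0$ (the zero polynomial is $\gamma$-positive).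 Every polynomial $f(x)$ of degree $m$ has a unique symmetric decomposition $(a(x),b(x))$, meaning $f(x)=a(x)+xb(x)$ with polynomials satisfying $a(x)=x^ma(1/x)$ and $b(x)=x^{m-1}b(1/x)$; explicitly $a(x)=\frac{f(x)-x^{m+1}f(1/x)}{1-x}$ and $b(x)=\frac{x^mf(1/x)-f(x)}{1-x}$. The polynomial $f(x)$ is bi-$\gamma$-positive if both $a(x)$ and $b(x)$ are $\gamma$-positive. *)

(* Defs.v *)
From HB Require Import structures.
From mathcomp Require Import all_boot all_order all_algebra.
From mathcomp Require Import all_classical all_reals all_analysis.
Set Implicit Arguments.
Unset Strict Implicit.
Unset Printing Implicit Defensive.
Import Order.TTheory GRing.Theory Num.Theory.
Import numFieldNormedType.Exports.
Local Open Scope classical_set_scope.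
Local Open Scope ring_scope.

Section JacobiElliptic.
Variable R : realType.
Implicit Types (k x u t : R).

Definition elliptic_integrand k t : R :=
  (Num.sqrt ((1 - t ^+ 2) * (1 - k ^+ 2 * t ^+ 2)))^-1.

(* The oriented integral from 0 to x: the library integrates over sets, so the
   sign for x < 0 has to be supplied. *)
Definition elliptic_integral k x : R :=
  if 0 <= x
  then (\int[lebesgue_measure]_(t in `[0, x]) elliptic_integrand k t)%R
  else - (\int[lebesgue_measure]_(t in `[x, 0]) elliptic_integrand k t)%R.

(* elliptic_integral k is an increasing bijection from ]-1, 1[ onto ]-K, K[,
   K being the complete elliptic integral of modulus k; sn k is its inverse.
   The value 0 that xget returns for |u| >= K is a dummy: only the germ of
   sn k at 0 is used below. *)
Definition sn k u : R :=
  xget 0 [set x : R | -1 < x < 1 /\ elliptic_integral k x = u].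

Definition cn k u : R := Num.sqrt (1 - sn k u ^+ 2).

(* [J n] stands for J_{2n}.  Evaluating the expansion for all k in (0, 1)
   determines every J n, a polynomial being determined by its values on an
   infinite set; its n = 0 term is the constant term 1. *)
Definition cn_taylor_polynomials (J : nat -> {poly R}) : Prop :=
  J 0%N = 1 /\
  forall k, 0 < k < 1 ->
    \forall u \near (0 : R),
      series (fun n : nat =>
        (-1) ^+ n * (J n).[k ^+ 2] * (u ^+ (2 * n) / ((2 * n)`!)%:R)) @ \oo
      --> cn k u.

End JacobiElliptic.

Section PolynomialProperties.
Variable R : realType.
Implicit Types (f h a b : {poly R}).

(* The degree of a nonzero polynomial; 0 by convention for the zero one. *)
Definition degree f : nat := (size f).-1.

Definition unimodal f : Prop :=
  exists2 r : nat, (r <= degree f)%N &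
    (forall i : nat, (i < r)%N -> f`_i <= f`_i.+1) /\
    (forall i : nat, (r <= i < degree f)%N -> f`_i.+1 <= f`_i).

(* The chain f_0 <= f_m <= f_1 <= f_(m-1) <= ... <= f_(floor((m+1)/2)), cut
   into the links f_i <= f_(m-i) and f_(m-i) <= f_(i+1). *)
Definition alternatingly_increasing f : Prop :=
  let m := degree f in
  (forall i : nat, (2 * i <= m)%N -> f`_i <= f`_(m - i)) /\
  (forall i : nat, (2 * i + 1 <= m)%N -> f`_(m - i) <= f`_i.+1).

(* h(x) = x^d h(1/x).  The exponent is an integer because the second component
   of the symmetric decomposition of a constant is taken with d = -1, which
   forces it to be 0. *)
Definition self_reciprocal (d : int) h : Prop :=
  forall x : R, x != 0 -> h.[x] = x ^ d * h.[x^-1].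

(* For h != 0 the integer d is determined by h; the zero polynomial is
   gamma-positive, with any d and g = 0. *)
Definition gamma_positive h : Prop :=
  exists (d : nat) (g : nat -> R),
    [/\ self_reciprocal d%:Z h,
        h = \sum_(0 <= i < (d./2).+1) g i *: ('X^i * (1 + 'X) ^+ (d - 2 * i))
      & forall i : nat, (i <= d./2)%N -> 0 <= g i].

Definition symmetric_decomposition f a b : Prop :=
  let m := degree f in
  [/\ f = a + 'X * b,
      self_reciprocal m%:Z a
    & self_reciprocal (m%:Z - 1) b].

Definition bi_gamma_positive f : Prop :=
  exists a b : {poly R},
    [/\ symmetric_decomposition f a b, gamma_positive a & gamma_positive b].

End PolynomialProperties.

(* Main.v *)
Require Import Defs.
From mathcomp Require Import all_boot all_order all_algebra.
From mathcomp Require Import all_classical all_reals all_analysis.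
From mathcomp Require Import zify ring lra.
Set Implicit Arguments.
Unset Strict Implicit.
Unset Printing Implicit Defensive.
Import Order.TTheory GRing.Theory Num.Theory.
Import numFieldNormedType.Exports.
Local Open Scope classical_set_scope.
Local Open Scope ring_scope.

(* Put x = k^2 and P = (dn - cn)/(1 - x), Q = (dn - x cn)/(1 - x), S = sn.
   Then cn = Q - P, dn = Q - x P and
     P' = S Q,  Q' = x S P,  S' = x P^2 - (1 + x) P Q + Q^2.
   With x in degree 2 and 1 + x in degree 1 this system is homogeneous, so the
   even derivatives of P and of Q at 0 are, up to sign, sums of products of x
   and 1 + x of a fixed degree; since dn corresponds to the reciprocal
   polynomial of J_{2n}, the two families are a(x) and x b(x).

   Neither the analyticity of cn nor an inverse function is needed: with
   F(t) = elliptic_integral k t one has cn k (F t) = sqrt (1 - t^2), and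
   differentiating a power series at F(t) repeatedly with respect to t
   identifies its coefficients. *)

(** * Cones of gamma-positive polynomials and their coefficient inequalities *)

Section GammaCone.
Variable R : realType.
Implicit Types (h f a b : {poly R}).

(** Sums of products X^i (1 + X)^j with 2 i + j = d, given by generators so that products and
    coefficient inequalities follow by induction. The index d is the exponent in h(x) = x^d h(1/x);
    it may exceed the degree, and 0 lies in every cone. *)
Inductive gamma_cone : nat -> {poly R} -> Prop :=
| gamma_cone0 d : gamma_cone d 0
| gamma_cone1 : gamma_cone 0 1
| gamma_coneX d h : gamma_cone d h -> gamma_cone d.+2 ('X * h)
| gamma_cone1X d h : gamma_cone d h -> gamma_cone d.+1 ((1 + 'X) * h)
| gamma_coneD d h f :
    gamma_cone d h -> gamma_cone d f -> gamma_cone d (h + f).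

Lemma gamma_coneM d e h f :
  gamma_cone d h -> gamma_cone e f -> gamma_cone (d + e) (h * f).
Proof.
move=> + fe; elim=> {d h} [d||d h _ ih|d h _ ih|d h1 h2 _ ih1 _ ih2].
- by rewrite mul0r; exact: gamma_cone0.
- by rewrite mul1r.
- by rewrite -mulrA; exact: gamma_coneX.
- by rewrite -mulrA; exact: gamma_cone1X.
- by rewrite mulrDl; exact: gamma_coneD.
Qed.

Lemma gamma_cone_self_reciprocal d h :
  gamma_cone d h -> self_reciprocal d%:Z h.
Proof.
elim=> {d h} [d||d h _ ih|d h _ ih|d h f _ ih1 _ ih2] x x0.
- by rewrite !horner0 mulr0.
- by rewrite !hornerC mulr1.
- rewrite !hornerM !hornerX (ih x x0) -!exprnP !exprS; field.
  exact: x0.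
- rewrite !hornerM !hornerD !hornerC !hornerX (ih x x0) -!exprnP !exprS; field.
  exact: x0.
- by rewrite !hornerD (ih1 x x0) (ih2 x x0) mulrDr.
Qed.

(** The vanishing of g beyond d / 2 serves the induction: multiplying by 1 + X with d odd lengthens
    the sum by one term, whose coefficient must be 0. *)
Lemma gamma_cone_expansion d h : gamma_cone d h ->
  exists g : nat -> R, [/\ forall i, 0 <= g i,
    forall i, (d < 2 * i)%N -> g i = 0 &
    h = \sum_(0 <= i < (d./2).+1) g i *: ('X^i * (1 + 'X) ^+ (d - 2 * i))].
Proof.
elim=> {d h} [d||d h _ [g [g0 gd ->]]|d h _ [g [g0 gd ->]]
  |d h f _ [g [g0 gd ->]] _ [g' [g'0 g'd ->]]].
- by exists (fun=> 0); split=> //; rewrite big1// => i _; rewrite scale0r.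
- exists (fun i => (i == 0)%:R); split=> [[]//|[]//|].
  by rewrite big_nat1 expr0 mul1r expr0 scale1r.
- exists (fun i => if i is j.+1 then g j else 0); split.
  + by case.
  + by case=> // i di; apply: gd; lia.
  + rewrite [RHS]big_nat_recl//= scale0r add0r big_distrr/=.
    apply: eq_bigr => i _.
    rewrite -scalerAr mulrA -exprS.
    by congr (_ *: (_ * _ ^+ _)); lia.
- exists g; split=> //; first by move=> i di; apply: gd; lia.
  have -> : \sum_(0 <= i < d.+1./2.+1) g i *: ('X^i * (1 + 'X) ^+ (d.+1 - 2 * i))
    = \sum_(0 <= i < d./2.+1) g i *: ('X^i * (1 + 'X) ^+ (d.+1 - 2 * i)).
    case/orP: (orbN (odd d)) => od.
      have -> : d.+1./2 = d./2.+1 by lia.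
      by rewrite big_nat_recr//= gd ?scale0r ?addr0//; lia.
    by have -> : d.+1./2 = d./2 by lia.
  rewrite big_distrr/= !big_nat; apply: eq_bigr => i /andP[_ id].
  rewrite -scalerAr mulrCA -exprS.
  by congr (_ *: (_ * _ ^+ _)); lia.
- exists (fun i => g i + g' i); split.
  + by move=> i; rewrite addr_ge0.
  + by move=> i di; rewrite gd// g'd// addr0.
  + by rewrite -big_split/=; apply: eq_bigr => i _; rewrite scalerDl.
Qed.

Lemma gamma_cone_gamma_positive d h : gamma_cone d h -> gamma_positive h.
Proof.
move=> dh; have [g [g0 _ hE]] := gamma_cone_expansion dh.
by exists d, g; split=> //; exact: gamma_cone_self_reciprocal.
Qed.

Definition palindromic_unimodal d h :=
  [/\ forall i, (d < i)%N -> h`_i = 0,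
      forall i j, (i + j = d)%N -> h`_i = h`_j,
      forall i, (2 * i < d)%N -> h`_i <= h`_i.+1
    & forall i, 0 <= h`_i].

Lemma gamma_cone_palindromic_unimodal d h :
  gamma_cone d h -> palindromic_unimodal d h.
Proof.
elim=> {d h} [d||d h _ [s p u g]|d h _ [s p u g]
  |d h f _ [s p u g] _ [s' p' u' g']].
- by split=> *; rewrite !coef0.
- split=> [i i0|i j||i]; rewrite ?coef1 ?ler0n//.
    by rewrite gtn_eqF.
  by case: i j => [|i] [|j].
- split.
  + by case=> // i di; rewrite coefXM/=; apply: s; lia.
  + case=> [|i] [|j] ijd; rewrite !coefXM//=.
    * by rewrite s//; lia.
    * by rewrite s//; lia.
    * by apply: p; lia.
  + by case=> [|i] di; rewrite !coefXM//=; apply: u; lia.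
  + by case=> [|i]; rewrite coefXM//=.
- have E i : ((1 + 'X) * h)`_i = h`_i + (if i is j.+1 then h`_j else 0).
    by rewrite mulrDl mul1r coefD coefXM; case: i.
  split.
  + by case=> // i di; rewrite E s ?add0r ?s//; lia.
  + case=> [|i] [|j] ijd; rewrite !E//.
    * by rewrite addr0 (s j.+1) ?add0r; [apply: p|]; lia.
    * by rewrite addr0 (s i.+1) ?add0r; [apply: p|]; lia.
    * by rewrite addrC; congr (_ + _); apply: p; lia.
  + case=> [|i] di; rewrite !E.
      by rewrite addr0 lerDr.
    rewrite addrC lerD2r.
    (* What remains is h_i <= h_(i+2): two ascents, unless i + 1 is the centre, where symmetry gives
       equality. *)
    have [eqd|ltd] := eqVneq (2 * i.+1)%N d.
      by rewrite (p i i.+2)//; lia.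
    by apply: (le_trans (u i _) (u i.+1 _)); lia.
  + by case=> [|i]; rewrite E ?addr0// addr_ge0.
- split=> *; rewrite !coefD.
  + by rewrite s ?s' ?addr0.
  + by congr (_ + _); [apply: p|apply: p'].
  + by rewrite lerD ?u ?u'.
  + by rewrite addr_ge0.
Qed.

Lemma alternatingly_increasing_unimodal f :
  alternatingly_increasing f -> unimodal f.
Proof.
rewrite /alternatingly_increasing /unimodal; move: (degree f) => m /= [lo hi].
exists m.+1./2; first by lia.
split=> i im.
  by apply: le_trans (lo i _) (hi i _); lia.
(* Right of the mode the links are read from the other end: f_(i+1) <= f_(m-i) <= f_i. *)
have := lo (m - i)%N; have := hi (m - i).-1.
have -> : (m - (m - i).-1)%N = i.+1 by lia.
have -> : (m - (m - i))%N = i by lia.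
have -> : (m - i).-1.+1 = (m - i)%N by lia.
by move=> hi' lo'; apply: le_trans (hi' _) (lo' _); lia.
Qed.

(** By symmetry f_i = a_i + b_(i-1) and f_(m-i) = a_i + b_i, so the two kinds of links reduce to
    b_(i-1) <= b_i and a_i <= a_(i+1), which are ascents in the first halves of b and a. *)
Lemma palindromic_unimodal_alternatingly_increasing f a b :
  f = a + 'X * b -> palindromic_unimodal (degree f) a ->
  palindromic_unimodal (degree f).-1 b -> alternatingly_increasing f.
Proof.
rewrite /alternatingly_increasing; move: (degree f) => m /= fE.
move=> [sa pa ua ga] [sb pb ub gb].
have E i : f`_i = a`_i + (if i is j.+1 then b`_j else 0).
  by rewrite fE coefD coefXM; case: i.
have E' i : (i < m)%N -> f`_(m - i) = a`_i + b`_i.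
  move=> im; have -> : (m - i)%N = (m - i.+1).+1 by lia.
  by rewrite E; congr (_ + _); [apply: pa|apply: pb]; lia.
split=> i im.
  have [m0|m0] := eqVneq m 0%N.
    by have -> : (m - i)%N = i by lia.
  rewrite E' ?E; last by lia.
  rewrite lerD2l; case: i im => [//|i] im.
  have [mE|mlt] := eqVneq (2 * i.+1)%N m; last by apply: ub; lia.
  by rewrite (pb i i.+1)//; lia.
by rewrite E' ?E ?lerD2r; [apply: ua|]; lia.
Qed.

End GammaCone.

(** * The differential system for P, Q, S as a graded formal derivation *)

Section Grammar.

(* tP, tQ, tS stand for P, Q, S; tX and tY multiply by x and by - (1 + x). *)
Inductive term :=
| tP | tQ | tS
| tX of term | tY of term
| tadd of term & term | tmul of term & term.

Fixpoint derivation e := match e with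
| tP => tmul tS tQ
| tQ => tX (tmul tS tP)
| tS => tadd (tadd (tX (tmul tP tP)) (tY (tmul tP tQ))) (tmul tQ tQ)
| tX e => tX (derivation e)
| tY e => tY (derivation e)
| tadd e1 e2 => tadd (derivation e1) (derivation e2)
| tmul e1 e2 => tadd (tmul (derivation e1) e2) (tmul e1 (derivation e2))
end.

(** The ring is left open because the same terms are read in [{poly R}] at u = 0, with x the
    indeterminate, and in [R] along the functions P, Q, S. *)
Fixpoint interp (A : comNzRingType) (x p q s : A) e := match e with
| tP => p
| tQ => q
| tS => s
| tX e => x * interp x p q s e
| tY e => - (1 + x) * interp x p q s e
| tadd e1 e2 => interp x p q s e1 + interp x p q s e2
| tmul e1 e2 => interp x p q s e1 * interp x p q s e2
end.

(* Twice the degree, each derivation adding 1/2.  Only S has an odd weight, and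
   a term involving P or S vanishes at u = 0. *)
Inductive weight : int -> term -> Prop :=
| weightP : weight (- 2) tP
| weightQ : weight 0 tQ
| weightS : weight (- 1) tS
| weightX w e : weight w e -> weight (w + 4) (tX e)
| weightY w e : weight w e -> weight (w + 2) (tY e)
| weight_add w e1 e2 : weight w e1 -> weight w e2 -> weight w (tadd e1 e2)
| weight_mul w1 w2 e1 e2 :
    weight w1 e1 -> weight w2 e2 -> weight (w1 + w2) (tmul e1 e2).

Lemma weight_derivation w e : weight w e -> weight (w + 1) (derivation e).
Proof.
elim=> {w e} /=.
- exact: weight_mul weightS weightQ.
- exact: weightX (weight_mul weightS weightP).
- apply: weight_add; last exact: weight_mul weightQ weightQ.
  apply: weight_add; first exact: weightX (weight_mul weightP weightP).
  exact: weightY (weight_mul weightP weightQ).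
- by move=> w e _ ih; rewrite addrAC; exact: weightX.
- by move=> w e _ ih; rewrite addrAC; exact: weightY.
- by move=> w e1 e2 _ ih1 _ ih2; exact: weight_add.
- move=> w1 w2 e1 e2 h1 ih1 h2 ih2; apply: weight_add.
    by rewrite addrAC; exact: weight_mul.
  by rewrite -addrA; exact: weight_mul.
Qed.

Lemma weight_iter_derivation n w e :
  weight w e -> weight (w + n%:Z) (iter n derivation e).
Proof.
move=> we; elim: n => [|n ih]; first by rewrite addr0.
by rewrite iterS -addn1 PoszD addrA; exact: weight_derivation.
Qed.

Lemma iter_derivation_tX n e :
  iter n derivation (tX e) = tX (iter n derivation e).
Proof. by elim: n => //= n ->. Qed.

(* The value at u = 0, where P = 0, Q = 1 and S = 0. *)
Definition eval0 (R : realType) : term -> {poly R} := interp 'X 0 1 0.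

(** A factor x raises d by 2 without a sign, and a factor - (1 + x) raises d by 1 with a sign. Hence
    the sign is (- 1)^d, fixed by the weight alone, and the summands of a term never cancel. *)
Lemma eval0_gamma_cone (R : realType) w e : weight w e -> eval0 R e = 0 \/
  exists d, w = 2 * d%:Z /\
    exists2 h, gamma_cone d h & eval0 R e = (- 1) ^+ d * h.
Proof.
rewrite /eval0; elim=> {w e} /=.
- by left.
- right; exists 0%N; split=> //; exists 1; first exact: gamma_cone1.
  by rewrite mul1r.
- by left.
- move=> w e _ [->|[d [-> [h hd ->]]]]; first by left; rewrite mulr0.
  right; exists d.+2; split; first by lia.
  by exists ('X * h); [exact: gamma_coneX|rewrite !exprS; ring].
- move=> w e _ [->|[d [-> [h hd ->]]]]; first by left; rewrite mulr0.
  right; exists d.+1; split; first by lia.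
  by exists ((1 + 'X) * h); [exact: gamma_cone1X|rewrite !exprS; ring].
- move=> w e1 e2 _ [->|[d [-> [h hd ->]]]] _.
    by rewrite add0r.
  move=> [->|[d' [dd' [h' hd' ->]]]].
    by right; exists d; split=> //; exists h => //; rewrite addr0.
  have dE : d = d' by lia.
  right; exists d; split=> //; exists (h + h').
    by apply: gamma_coneD => //; rewrite dE.
  by rewrite dE mulrDr.
- move=> w1 w2 e1 e2 _ [->|[d [-> [h hd ->]]]] _.
    by rewrite mul0r; left.
  move=> [->|[d' [-> [h' hd' ->]]]]; first by rewrite mulr0; left.
  right; exists (d + d')%N; split; first by lia.
  exists (h * h'); first exact: gamma_coneM.
  by rewrite exprD; ring.
Qed.

End Grammar.

(** * The two components of the symmetric decomposition *)

Section Decomposition.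
Variable R : realType.
Implicit Types f : {poly R}.

(** From cn = Q - P, the polynomial J_{2n} is (- 1)^n times the derivative of order 2 n of Q - P at
    u = 0. For n >= 1 this is the contribution of P, the minus sign being absorbed in the exponent
    [n.-1]. *)
Definition apart n : {poly R} :=
  (- 1) ^+ n.-1 * eval0 R (iter (2 * n) derivation tP).

(* One factor x has been removed from Q' = x S P. *)
Definition bpart n : {poly R} :=
  (- 1) ^+ n * eval0 R (iter (2 * n).-1 derivation (tmul tS tP)).

(** The weight is - 2 + 2 (n + 1) = 2 n, so the cone has index n and the two signs (- 1)^n
    cancel. *)
Lemma apart_gamma_cone n : gamma_cone n (apart n.+1).
Proof.
rewrite /apart /=.
have /(eval0_gamma_cone R) [->|[d [dE [h hd ->]]]] :=
  weight_iter_derivation (2 * n.+1) weightP.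
  by rewrite mulr0; exact: gamma_cone0.
have -> : n = d by lia.
by rewrite mulrA -exprMn mulrNN mul1r expr1n mul1r.
Qed.

(** The product S P has weight - 3, and 2 n + 3 derivations bring it to 2 n. *)
Lemma bpart_gamma_cone n : gamma_cone n (bpart n.+2).
Proof.
rewrite /bpart.
have /(eval0_gamma_cone R) [->|[d [dE [h hd ->]]]] :=
  weight_iter_derivation (2 * n.+2).-1 (weight_mul weightS weightP).
  by rewrite mulr0; exact: gamma_cone0.
have -> : n = d by lia.
by rewrite mulrA !exprS !mulrA mulrNN !mul1r -exprMn mulrNN mul1r expr1n mul1r.
Qed.

Lemma bpart1 : bpart 1 = 0.
Proof. by rewrite /bpart /eval0 /=; ring. Qed.

Lemma bi_gamma_positive_decomposition f n :
  f = apart n.+1 + 'X * bpart n.+1 -> (apart n.+1).[0] = 1 ->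
  [/\ bi_gamma_positive f, alternatingly_increasing f & unimodal f].
Proof.
move=> fE a1; have aC := apart_gamma_cone n.
(* For n = 0 the truncated index [n.-1] is 0 in place of - 1, which is harmless because [bpart 1]
   vanishes. *)
have bC : gamma_cone n.-1 (bpart n.+1).
  case: n fE a1 aC => [|n] _ _ _; last exact: bpart_gamma_cone.
  by rewrite bpart1; exact: gamma_cone0.
have [sa pa ua ga] := gamma_cone_palindromic_unimodal aC.
have [sb pb ub gb] := gamma_cone_palindromic_unimodal bC.
have b0 : n = 0%N -> bpart n.+1 = 0 by move=> ->; exact: bpart1.
have fn : degree f = n.
  rewrite /degree.
  suff -> : size f = n.+1 by [].
  apply/eqP; rewrite eqn_leq; apply/andP; split.
    apply/leq_sizeP => i ni; rewrite fE coefD coefXM sa// add0r.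
    case: i ni => // i ni; have [n0|n0] := eqVneq n 0%N.
      by rewrite b0// coef0.
    by rewrite sb//; lia.
  rewrite ltnNge; apply/negP => /leq_sizeP /(_ n (leqnn _)).
  rewrite fE coefD coefXM (pa n 0%N) ?addn0// -horner_coef0 a1.
  case: (n) (gb n.-1) => /= [_|m bm] /eqP.
    by rewrite addr0 oner_eq0.
  by rewrite gt_eqF// ltr_pwDl.
have alt : alternatingly_increasing f.
  apply: palindromic_unimodal_alternatingly_increasing fE _ _; rewrite fn.
    exact: gamma_cone_palindromic_unimodal.
  exact: gamma_cone_palindromic_unimodal.
split=> //; last exact: alternatingly_increasing_unimodal.
exists (apart n.+1), (bpart n.+1); split.
- split; rewrite ?fn//; first exact: gamma_cone_self_reciprocal.
  case: n b0 bC {fE a1 aC sa pa ua ga sb pb ub gb fn} => [->// _|n _].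
    by move=> x _; rewrite !horner0 mulr0.
  have -> : (n.+1%:Z - 1 = n%:Z)%R by lia.
  exact: gamma_cone_self_reciprocal.
- exact: gamma_cone_gamma_positive aC.
- exact: gamma_cone_gamma_positive bC.
Qed.

Lemma bi_gamma_positive1 : [/\ bi_gamma_positive (1 : {poly R}),
  alternatingly_increasing (1 : {poly R}) & unimodal (1 : {poly R})].
Proof.
have d1 : degree (1 : {poly R}) = 0%N by rewrite /degree size_polyC oner_eq0.
have alt : alternatingly_increasing (1 : {poly R}).
  apply: (@palindromic_unimodal_alternatingly_increasing _ _ 1 0).
  - by rewrite mulr0 addr0.
  - by rewrite d1; exact: gamma_cone_palindromic_unimodal (gamma_cone1 R).
  - exact: gamma_cone_palindromic_unimodal (gamma_cone0 R _).
split=> //; last exact: alternatingly_increasing_unimodal.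
exists 1, 0; split.
- split; first by rewrite mulr0 addr0.
    by rewrite d1; exact: gamma_cone_self_reciprocal (gamma_cone1 R).
  by move=> x _; rewrite !horner0 mulr0.
- exact: gamma_cone_gamma_positive (gamma_cone1 R).
- exact: gamma_cone_gamma_positive (gamma_cone0 R 0).
Qed.

End Decomposition.

(** * Terms differentiated along functions, and the constant coefficient of a(x) *)

Section Derivative.
Variable R : realType.

Lemma interp_eval0 (x : R) e : (eval0 R e).[x] = interp x 0 1 0 e.
Proof.
rewrite /eval0; elim: e => /= [||||||].
- by rewrite horner0.
- by rewrite hornerC.
- by rewrite horner0.
- by move=> e ih; rewrite hornerM hornerX ih.
- by move=> e ih; rewrite hornerM hornerN hornerD hornerC hornerX ih.
- by move=> e1 ih1 e2 ih2; rewrite hornerD ih1 ih2.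
- by move=> e1 ih1 e2 ih2; rewrite hornerM ih1 ih2.
Qed.

Lemma is_derive_unique (f : R -> R) (t a b : R) :
  is_derive t 1 f a -> is_derive t 1 f b -> a = b.
Proof. by move=> [_ <-] [_ <-]. Qed.

(** This is the chain rule for a change of variable: [derivation] is d/du, and the factor w = du/dt
    turns it into d/dt. The elliptic case uses t = sn u. *)
Lemma is_derive_interp (x : R) (p q s : R -> R) (t w : R) :
  is_derive t 1 p (w * interp x (p t) (q t) (s t) (derivation tP)) ->
  is_derive t 1 q (w * interp x (p t) (q t) (s t) (derivation tQ)) ->
  is_derive t 1 s (w * interp x (p t) (q t) (s t) (derivation tS)) ->
  forall e, is_derive t 1 (fun u => interp x (p u) (q u) (s u) e)
    (w * interp x (p t) (q t) (s t) (derivation e)).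
Proof.
move=> dp dq ds; elim=> //.
- move=> e ih /=.
  rewrite [X in is_derive _ _ X _](_ : _ =
    x \*: (fun u => interp x (p u) (q u) (s u) e)); last by apply/funext.
  by apply: is_derive_eq; rewrite /GRing.scale/=; ring.
- move=> e ih /=.
  rewrite [X in is_derive _ _ X _](_ : _ =
    (- (1 + x)) \*: (fun u => interp x (p u) (q u) (s u) e)); last by apply/funext.
  by apply: is_derive_eq; rewrite /GRing.scale/=; ring.
- move=> e1 ih1 e2 ih2 /=.
  apply: (is_derive_eq (is_deriveD ih1 ih2)); ring.
- move=> e1 ih1 e2 ih2 /=.
  by apply: (is_derive_eq (is_deriveM ih1 ih2)); rewrite /GRing.scale/=; ring.
Qed.

(* For x = 0 the functions P, Q, S are 1 - cos, 1, sin. *)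
Lemma apart_at0 n : (apart R n.+1).[0] = 1.
Proof.
pose F m (t : R) := interp 0 (1 - cos t) 1 (sin t) (iter m derivation tP).
have dF m (t : R) : is_derive t 1 (F m) (F m.+1 t).
  rewrite -[F m.+1 t]mul1r.
  apply: (@is_derive_interp 0 (fun u : R => 1 - cos u) (fun=> 1) (@sin R)) => /=.
  - apply: (is_derive_eq (is_deriveB (is_derive_cst _ _ _) (is_derive_cos t))).
    by ring.
  - by apply: (is_derive_eq (is_derive_cst _ _ _)); ring.
  - by apply: (is_derive_eq (is_derive_sin t)); ring.
(* Uniqueness of derivatives passes a closed form of one derivative to the next without unfolding
   the iterated term. *)
have FS m (a : R) (g g' : R -> R) : (forall t : R, is_derive t 1 g (g' t)) ->
    F m = (fun t => a * g t) -> F m.+1 = (fun t => a * g' t).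
  move=> dg Fm; apply/funext => t.
  have dag : is_derive t 1 (a \*: g) (a *: g' t) by exact: is_deriveZ.
  by apply: is_derive_unique (dF m t) _; rewrite Fm.
have Fsc j : F (2 * j).+1 = (fun t => (- 1) ^+ j * sin t) /\
             F (2 * j).+2 = (fun t => (- 1) ^+ j * cos t).
  have dsin (t : R) : is_derive t 1 (@sin R) (cos t) by exact: is_derive_sin.
  have dcos (t : R) : is_derive t 1 (@cos R) (- sin t) by exact: is_derive_cos.
  suff Fs : F (2 * j).+1 = (fun t => (- 1) ^+ j * sin t).
    by split=> //; exact: FS dsin Fs.
  elim: j => [|j /(FS _ _ _ _ dsin)/(FS _ _ _ _ dcos) Fj].
    by apply/funext => t; rewrite /F/=; ring.
  rewrite (_ : (2 * j.+1).+1 = (2 * j).+3)//; last by lia.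
  by rewrite Fj; apply/funext => t; rewrite exprS; ring.
have [_ /(congr1 (@^~ 0))] := Fsc n.
rewrite /F cos0 sin0 subrr mulr1.
rewrite /apart hornerM interp_eval0 (_ : (2 * n).+2 = 2 * n.+1)%N; last by lia.
move=> ->; rewrite horner_exp hornerN hornerC.
by rewrite -exprMn mulrNN mul1r expr1n.
Qed.

End Derivative.

(** * Termwise differentiation of power series and identification of coefficients *)

Section PowerSeries.
Variable R : realType.
Implicit Types (c : R^nat) (r u z : R).

Lemma near_norm_lt (t d : R) : `|t| < d -> \forall v \near t, `|v| < d.
Proof.
by move=> td; apply: (@cvgr_lt R _ _ _ _ _ (@norm_continuous _ R^o t)).
Qed.

(** For |u| < z < r and q = |u| / z, the factor (n + 1) q^n is bounded, so the differentiated series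
    at u is dominated by a multiple of the absolutely convergent series at z. *)
Lemma cvg_pseries_diffs c r : (forall u, `|u| < r -> cvgn (pseries c u)) ->
  forall u, `|u| < r -> cvgn (pseries (pseries_diffs c) u).
Proof.
move=> cvgc u ur.
pose z := (`|u| + r) / 2.
have uz : `|u| < z by rewrite /z; lra.
have z0 : 0 < z by apply: le_lt_trans uz.
have zr : z < r by rewrite /z; lra.
(* Convergence at z' gives absolute convergence at the smaller z. *)
pose z' := (z + r) / 2.
have zz' : z < z' by rewrite /z'; lra.
have z'r : z' < r by rewrite /z'; lra.
have Cz : cvgn (pseries (fun i => `|c i|) z).
  apply: (@is_cvg_pseries_inside_norm _ _ z').
    by apply: cvgc; rewrite ger0_norm//; lra.
  by rewrite !ger0_norm//; lra.
apply: normed_cvg; rewrite /normed_series_of /=.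
pose q := `|u| / z.
have q0 : 0 <= q by rewrite divr_ge0// ltW.
have q1 : q < 1 by rewrite ltr_pdivrMr// mul1r.
(* (n + 1) q^n <= 1 + q + ... + q^n *)
have bern n : n.+1%:R * q ^+ n <= (1 - q)^-1.
  apply: (@le_trans _ _ (\sum_(i < n.+1) q ^+ i)).
    rewrite mulr_natl -[n.+1 in leLHS]card_ord -sumr_const.
    apply: ler_sum => i _; apply: ler_wiXn2l => //; first exact: ltW.
    by rewrite -ltnS.
  rewrite -[leRHS]mul1r ler_pdivlMr ?subr_gt0// mulrC -opprB mulNr -subrX1.
  by rewrite opprB lerBlDr lerDl exprn_ge0.
apply: (@series_le_cvg _ _ (fun n => ((1 - q)^-1 / z) * (`|c n.+1| * z ^+ n.+1))).
- by move=> n; rewrite normr_ge0.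
- by move=> n; rewrite !mulr_ge0 ?invr_ge0 ?exprn_ge0//; lra.
- move=> n /=; rewrite /pseries_diffs !normrM normrX normr_nat.
  rewrite [leRHS](_ : _ = (1 - q)^-1 * (`|c n.+1| * z ^+ n)); last first.
    by rewrite exprS; set a := (1 - q)^-1; field; rewrite gt_eqF.
  rewrite [leLHS](_ : _ = (n.+1%:R * q ^+ n) * (`|c n.+1| * z ^+ n)); last first.
    by rewrite /q exprMn exprVn; field; rewrite expf_neq0// gt_eqF.
  by apply: ler_wpM2r => //; rewrite mulr_ge0// exprn_ge0// ltW.
- apply: is_cvg_seriesZ.
  pose v n := `|c n| * z ^+ n.
  rewrite (_ : series _ = (fun n => series v n.+1 - v 0%N)); last first.
    by apply/funext => n; rewrite /series/= big_nat_recl//= addrC addKr.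
  apply: is_cvgB; last exact: is_cvg_cst.
  by move/cvg_ex: Cz => [l Cl]; apply/cvg_ex; exists l; rewrite cvg_shiftS.
Qed.

Lemma is_derive_pseries c r : (forall u, `|u| < r -> cvgn (pseries c u)) ->
  forall u, `|u| < r -> is_derive u 1 (fun v => limn (pseries c v))
    (limn (pseries (pseries_diffs c) u)).
Proof.
move=> cvgc u ur.
have cvg1 := cvg_pseries_diffs cvgc.
have cvg2 := cvg_pseries_diffs cvg1.
have u0 : 0 <= `|u| by [].
have h : `|(`|u| + r) / 2| < r by rewrite ger0_norm; lra.
apply: (@pseries_snd_diffs _ _ ((`|u| + r) / 2)); [exact: cvgc|exact: cvg1|
  exact: cvg2|].
by rewrite [ltRHS]ger0_norm; lra.
Qed.

Lemma limn_pseries0 c : limn (pseries c 0) = c 0%N.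
Proof.
apply/cvg_lim => //; rewrite -(cvg_shiftn 1).
rewrite [X in X @ _ --> _](_ : _ = fun=> c 0%N); first exact: cvg_cst.
apply/funext => n; rewrite /pseries /series /= addn1 big_nat_recl//= expr0 mulr1.
by rewrite big1 ?addr0// => i _; rewrite exprS mul0r mulr0.
Qed.

Lemma iter_pseries_diffs c n i :
  i`!%:R * iter n (@pseries_diffs R) c i = (n + i)`!%:R * c (n + i)%N.
Proof.
elim: n i => [|n ih] i; first by [].
rewrite iterS /pseries_diffs mulrA -natrM mulnC -factS ih.
by rewrite addSnnS.
Qed.

(** Differentiating the identity in t puts the nonzero factor w = F' on both sides. Cancelling it
    leaves the same identity for the differentiated series and the derived terms; after n rounds, t
    = 0 isolates n! c_n. *)
Lemma pseries_coef c r (F w p q s : R -> R) (x d : R) e1 e2 :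
  (forall u, `|u| < r -> cvgn (pseries c u)) -> 0 < d -> F 0 = 0 ->
  (forall t : R, `|t| < d -> w t != 0 /\ `|F t| < r) ->
  (forall t : R, `|t| < d -> is_derive t 1 F (w t)) ->
  (forall t : R, `|t| < d -> [/\
    is_derive t 1 p (w t * interp x (p t) (q t) (s t) (derivation tP)),
    is_derive t 1 q (w t * interp x (p t) (q t) (s t) (derivation tQ)) &
    is_derive t 1 s (w t * interp x (p t) (q t) (s t) (derivation tS))]) ->
  (forall t : R, `|t| < d -> limn (pseries c (F t)) =
    interp x (p t) (q t) (s t) e1 - interp x (p t) (q t) (s t) e2) ->
  forall n, n`!%:R * c n =
    interp x (p 0) (q 0) (s 0) (iter n derivation e1) -
    interp x (p 0) (q 0) (s 0) (iter n derivation e2).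
Proof.
move=> cvgc d0 F0 wF dF dpqs cE n.
pose I e (t : R) := interp x (p t) (q t) (s t) e.
have cvgn m u : `|u| < r -> cvgn (pseries (iter m (@pseries_diffs R) c) u).
  by elim: m u => [//|m ih] u; apply: cvg_pseries_diffs.
have dI e (t : R) : `|t| < d -> is_derive t 1 (I e) (w t * I (derivation e) t).
  by move=> /dpqs[dp dq ds]; exact: is_derive_interp.
have H m (t : R) : `|t| < d -> limn (pseries (iter m (@pseries_diffs R) c) (F t)) =
    I (iter m derivation e1) t - I (iter m derivation e2) t.
  elim: m t => [|m ih] t td; first exact: cE.
  have [w0 Fr] := wF t td.
  have dl := is_derive_pseries (@cvgn m) Fr.
  have dc := is_derive1_comp dl (dF t td).
  have dr := is_deriveB (dI (iter m derivation e1) t td)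
                        (dI (iter m derivation e2) t td).
  have {}dc : is_derive t 1 (I (iter m derivation e1) - I (iter m derivation e2))
      (limn (pseries (iter m.+1 (@pseries_diffs R) c) (F t)) * w t).
    apply: near_eq_is_derive dc.
    near=> v; rewrite /= ih//.
    by near: v; exact: near_norm_lt.
  have /eqP := is_derive_unique dc dr.
  rewrite -mulrBr mulrC (inj_eq (mulfI w0)) => /eqP.
  by rewrite !iterS.
have := H n 0; rewrite normr0 F0 limn_pseries0 => /(_ d0).
rewrite /I => <-.
by have := iter_pseries_diffs c n 0; rewrite addn0 fact0 mul1r => ->.
Unshelve. all: by end_near. Qed.

End PowerSeries.

(** * The elliptic integral, its derivative, and cn along it *)

Section Elliptic.
Variable R : realType.
Implicit Types (k t x y c : R).

Lemma one_sub_sqr_gt0 k t : 0 < k <= 1 -> `|t| < 1 -> 0 < 1 - k ^+ 2 * t ^+ 2.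
Proof.
rewrite ltr_norml => /andP[k0 k1] /andP[t1 t2].
suff : k ^+ 2 * t ^+ 2 <= t ^+ 2 by nra.
by rewrite ler_piMl ?sqr_ge0// expr_le1// ltW.
Qed.

(* At t = sn u this is dn u, and cn u for k = 1. *)
Definition delta k t := Num.sqrt (1 - k ^+ 2 * t ^+ 2).

Lemma delta_gt0 k t : 0 < k <= 1 -> `|t| < 1 -> 0 < delta k t.
Proof. by move=> k01 t1; rewrite sqrtr_gt0 one_sub_sqr_gt0. Qed.

Lemma is_derive_delta k t : 0 < k <= 1 -> `|t| < 1 ->
  is_derive t 1 (delta k) (- (k ^+ 2 * t) / delta k t).
Proof.
move=> k01 t1.
have d : is_derive t 1 (fun u : R => 1 - k ^+ 2 * u ^+ 2) (- (k ^+ 2 * (2 * t))).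
  rewrite [X in is_derive _ _ X _](_ : _ = cst 1 - k ^+ 2 \*: (id ^+ 2)).
    by apply: is_derive_eq; rewrite /GRing.scale/=; ring.
  by apply/funext.
have ds := is_derive1_sqrt (one_sub_sqr_gt0 k01 t1).
rewrite (_ : delta k = Num.sqrt \o (fun u : R => 1 - k ^+ 2 * u ^+ 2))//.
apply: (is_derive_eq (@is_derive1_comp _ _ (fun u => 1 - k ^+ 2 * u ^+ 2) _ _ _ ds d)).
have := delta_gt0 k01 t1; rewrite /delta => a0.
rewrite /=; move: a0; set a := Num.sqrt _ => a0.
by field; rewrite gt_eqF.
Qed.

Lemma elliptic_integrandE k t : 0 < k < 1 -> `|t| < 1 ->
  elliptic_integrand k t = (delta 1 t * delta k t)^-1.
Proof.
move=> k01 t1; rewrite /elliptic_integrand /delta expr1n mul1r sqrtrM//.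
by have := @one_sub_sqr_gt0 1 t; rewrite ltr01 lexx expr1n mul1r => /(_ isT t1)/ltW.
Qed.

Lemma continuous_elliptic_integrand k t : 0 < k < 1 -> `|t| < 1 ->
  {for t, continuous (elliptic_integrand k)}.
Proof.
move=> /andP[k0 k1] t1.
have c1 : 0 < (1 : R) <= 1 by rewrite ltr01 lexx.
have ck : 0 < k <= 1 by rewrite k0 ltW.
have d : is_derive t 1 (fun u => delta 1 u * delta k u)
    (delta 1 t *: (- (k ^+ 2 * t) / delta k t) +
     delta k t *: (- (1 ^+ 2 * t) / delta 1 t)).
  exact: is_deriveM (is_derive_delta c1 t1) (is_derive_delta ck t1).
have cont : {for t, continuous (fun u => (delta 1 u * delta k u)^-1)}.
  apply: continuousV; first by rewrite mulf_neq0// gt_eqF// delta_gt0.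
  by apply/differentiable_continuous/derivable1_diffP; case: d.
rewrite /prop_for /continuous_at elliptic_integrandE ?k0//.
apply: cvg_trans cont; apply: near_eq_cvg.
by near=> u; rewrite elliptic_integrandE ?k0//; near: u; exact: near_norm_lt.
Unshelve. all: by end_near. Qed.

Lemma integrable_elliptic_integrand k x y : 0 < k < 1 ->
  -1 < x -> y < 1 ->
  (@lebesgue_measure R).-integrable `[x, y] (EFin \o elliptic_integrand k).
Proof.
move=> k01 x1 y1; apply: continuous_compact_integrable.
  exact: segment_compact.
apply: continuous_in_subspaceT => t; rewrite inE/= in_itv/= => /andP[xt ty].
by apply: continuous_elliptic_integrand => //; rewrite ltr_norml; lra.
Qed.

(** Moving the base point from 0 to - c removes the case distinction on the sign of x and makes x
    interior to the interval, ready for the fundamental theorem of calculus. *)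
Lemma elliptic_integralE k c x : 0 < k < 1 -> 0 < c < 1 -> `|x| < c ->
  elliptic_integral k x =
  (\int[lebesgue_measure]_(t in `[- c, x]) elliptic_integrand k t)%R -
  (\int[lebesgue_measure]_(t in `[- c, 0]) elliptic_integrand k t)%R.
Proof.
move=> k01 /andP[c0 c1]; rewrite ltr_norml => /andP[cx xc].
have int a b : -1 < a -> b < 1 ->
    (@lebesgue_measure R).-integrable `[a, b] (EFin \o elliptic_integrand k).
  exact: integrable_elliptic_integrand.
have int' a b : -1 < a -> b < 1 ->
    (@lebesgue_measure R).-integrable `]a, b] (EFin \o elliptic_integrand k).
  move=> a1 b1; apply: integrableS (int a b a1 b1) => //.
  by apply: subset_itvr; rewrite bnd_simp.
rewrite /elliptic_integral; case: leP => x0.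
  rewrite Rintegral_itvB ?bnd_simp ?Rintegral_itv_obnd_cbnd//.
  - by apply: int'; lra.
  - by apply: int; lra.
  - by lra.
rewrite -opprB Rintegral_itvB ?bnd_simp ?Rintegral_itv_obnd_cbnd//.
- by apply: int'; lra.
- by apply: int; lra.
- by lra.
- by lra.
Qed.

Lemma is_derive_elliptic_integral k x : 0 < k < 1 -> `|x| < 1 ->
  is_derive x 1 (elliptic_integral k) (elliptic_integrand k x).
Proof.
move=> k01 x1.
have x0 : 0 <= `|x| by [].
(* The midpoint of |x| and 1: x is interior to [- c, c], which stays away from the singularities at
   - 1 and 1. *)
pose c := (1 + `|x|) / 2.
have xc : `|x| < c by rewrite /c; lra.
have c01 : 0 < c < 1 by rewrite /c; lra.
pose G y := (\int[lebesgue_measure]_(t in `[- c, y]) elliptic_integrand k t)%R.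
have [||||d dE] := @continuous_FTC1_closed R (elliptic_integrand k) (- c) x c.
- by move: xc; rewrite ltr_norml => /andP[].
- by apply: integrable_elliptic_integrand => //; lra.
- by move: xc; rewrite ltr_norml => /andP[].
- exact: continuous_elliptic_integrand.
have dG : is_derive x 1 (G - cst (G 0)) (elliptic_integrand k x).
  have dG : is_derive x 1 G (elliptic_integrand k x).
    by constructor=> //; rewrite -derive1E.
  by apply: is_derive_eq; rewrite subr0.
apply: near_eq_is_derive dG; near=> y.
rewrite (@elliptic_integralE k c)//; near: y; exact: near_norm_lt.
Unshelve. all: by end_near. Qed.

(** The derivative is the integrand, which is positive. Injectivity makes t the only value that
    [xget] can choose in [sn k (elliptic_integral k t)]. *)
Lemma elliptic_integral_inj k x y : 0 < k < 1 -> `|x| < 1 -> `|y| < 1 ->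
  elliptic_integral k x = elliptic_integral k y -> x = y.
Proof.
move=> k01 x1 y1.
have lt : {in `]-1, 1[ &, {homo elliptic_integral k : x y / x < y}}.
  have N t : t \in `]-1, 1[ -> `|t| < 1 by rewrite in_itv/= ltr_norml.
  apply: gtr0_derive1_lt_oo => t => [/N t1|/N t1|/set_mem/N t1].
  - by have [] := is_derive_elliptic_integral k01 t1.
  - rewrite derive1E (@derive_val _ _ _ _ _ _ _ (is_derive_elliptic_integral k01 t1)).
    rewrite elliptic_integrandE// invr_gt0 mulr_gt0// delta_gt0//.
      by rewrite ltr01 lexx.
    by case/andP: k01 => -> /ltW.
  - apply/differentiable_continuous/derivable1_diffP.
    by have [] := is_derive_elliptic_integral k01 t1.
have M t : `|t| < 1 -> t \in `]-1, 1[ by rewrite in_itv/= ltr_norml.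
have [xy|xy|//] := ltgtP x y => E.
  by have := lt _ _ (M _ x1) (M _ y1) xy; rewrite E ltxx.
by have := lt _ _ (M _ y1) (M _ x1) xy; rewrite E ltxx.
Qed.

Lemma elliptic_integral0 k : elliptic_integral k 0 = 0.
Proof.
by rewrite /elliptic_integral lexx set_itv1 Rintegral_set1.
Qed.

Lemma cn_elliptic_integral k t : 0 < k < 1 -> `|t| < 1 ->
  cn k (elliptic_integral k t) = delta 1 t.
Proof.
move=> k01 t1; rewrite /cn /delta expr1n mul1r.
congr (Num.sqrt (1 - _ ^+ 2)); apply: xget_unique.
  by split=> //; move: t1; rewrite ltr_norml.
move=> y [y1 /elliptic_integral_inj]; apply=> //.
by rewrite ltr_norml.
Qed.

End Elliptic.

(** * Taylor coefficients of cn and comparison of polynomials *)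

Section Coefficients.
Variable R : realType.

Definition even_coef (a : R^nat) i : R := if odd i then 0 else a i./2.

(** Among the indices below N, exactly [uphalf N] are even, so the partial sums in u are those in
    u^2 with each one repeated. *)
Lemma series_even_coef (a : R^nat) (u l : R) :
  series (fun n => a n * u ^+ (2 * n)) @ \oo --> l ->
  pseries (even_coef a) u @ \oo --> l.
Proof.
move=> al.
have -> : pseries (even_coef a) u =
    (fun N => series (fun n => a n * u ^+ (2 * n)) (uphalf N)).
  apply/funext; elim=> [|N ih]; first by rewrite /pseries /series/= !big_geq.
  have -> : pseries (even_coef a) u N.+1 =
      pseries (even_coef a) u N + even_coef a N * u ^+ N.
    by rewrite /pseries /series /= big_nat_recr.
  rewrite ih /even_coef; case: ifPn => oN.
    by rewrite mul0r addr0; congr (series _ _); lia.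
  have -> : uphalf N.+1 = (uphalf N).+1 by lia.
  rewrite [RHS]/series/= big_nat_recr//=.
  by congr (_ + a _ * _ ^+ _); lia.
apply: cvg_comp al; apply/cvgnyPge => A; near=> N.
have : (2 * A <= N)%N by near: N; exact: nbhs_infty_ge.
by lia.
Unshelve. all: by end_near. Qed.

Lemma cn_taylor_coef (a : R^nat) (k : R) : 0 < k < 1 ->
  (\forall u \near (0 : R),
    series (fun n => a n * u ^+ (2 * n)) @ \oo --> cn k u) ->
  forall n, ((2 * n)`!)%:R * a n =
    interp (k ^+ 2) 0 1 0 (iter (2 * n) derivation tQ) -
    interp (k ^+ 2) 0 1 0 (iter (2 * n) derivation tP).
Proof.
move=> k01 /nbhs_norm0P[r /= r0 ar] n.
have k1 : 0 < (1 : R) <= 1 by rewrite ltr01 lexx.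
have kk : 0 < k <= 1 by case/andP: k01 => -> /ltW.
have kne : 1 - k ^+ 2 != 0.
  by rewrite gt_eqF// subr_gt0; case/andP: k01 => k0 k1'; nra.
have pr u : `|u| < r -> pseries (even_coef a) u @ \oo --> cn k u.
  by move=> ur; apply: series_even_coef; exact: ar.
have contF : elliptic_integral k t @[t --> (0 : R)] --> (0 : R).
  rewrite -[X in _ --> X](elliptic_integral0 k).
  apply/differentiable_continuous/derivable1_diffP.
  by have [] := @is_derive_elliptic_integral _ k 0 k01; rewrite ?normr0.
(* For |t| < d, the point t lies in ]-1, 1[ and its elliptic integral lies in the disc where the
   series converges to cn. *)
have /nbhs_norm0P[d /= d0 dF] : \forall t \near (0 : R),
    `|t| < 1 /\ `|elliptic_integral k t| < r.
  near=> t; split; near: t; first by apply: near_norm_lt; rewrite normr0.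
  have := contF => /cvgr0Pnorm_lt; exact.
pose C := @delta R 1; pose D := @delta R k.
(* In the variable t = sn u, C is cn and D is dn; the three functions supplied are P, Q, S, with Q -
   P = C and values 0, 1, 0 at t = 0. *)
have := @pseries_coef R (even_coef a) r (elliptic_integral k)
  (elliptic_integrand k) (fun t => (D t - C t) / (1 - k ^+ 2))
  (fun t => (D t - k ^+ 2 * C t) / (1 - k ^+ 2)) id (k ^+ 2) d tQ tP.
have C0 : C 0 = 1 by rewrite /C /delta expr0n/= mulr0 subr0 sqrtr1.
have D0 : D 0 = 1 by rewrite /D /delta expr0n/= mulr0 subr0 sqrtr1.
rewrite C0 D0 subrr mul0r mulr1 divff//.
move=> /(_ _ d0 (elliptic_integral0 k)) H.
have := H _ _ _ _ _ (2 * n)%N.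
rewrite /even_coef oddM/= mul2n doubleK; apply=> {H}.
- by move=> u ur; apply/cvg_ex; exists (cn k u); exact: pr.
- move=> t /dF[t1 tr]; split=> //.
  by rewrite elliptic_integrandE// invr_eq0 mulf_neq0// gt_eqF// delta_gt0.
- by move=> t /dF[t1 tr]; exact: is_derive_elliptic_integral.
- move=> t /dF[t1 tr].
  have Ct : C t != 0 by rewrite gt_eqF// delta_gt0.
  have Dt : D t != 0 by rewrite gt_eqF// delta_gt0.
  have dC : is_derive t 1 C (- t / C t).
    by apply: (is_derive_eq (is_derive_delta k1 t1)); rewrite expr1n mul1r.
  have dD : is_derive t 1 D (- (k ^+ 2 * t) / D t).
    exact: is_derive_delta.
  rewrite elliptic_integrandE// -/C -/D; split.
  + rewrite [X in is_derive _ _ X _](_ : _ = (1 - k ^+ 2)^-1 \*: (D - C)).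
      by apply: is_derive_eq; rewrite /GRing.scale/=; field; rewrite Ct Dt kne.
    by apply/funext => u; rewrite mulrC.
  + rewrite [X in is_derive _ _ X _](_ : _ =
        (1 - k ^+ 2)^-1 \*: (D - k ^+ 2 \*: C)).
      by apply: is_derive_eq; rewrite /GRing.scale/=; field; rewrite Ct Dt kne.
    by apply/funext => u; rewrite mulrC.
  + by apply: is_derive_eq; rewrite /=; field; rewrite Ct Dt kne.
- move=> t /dF[t1 tr] /=.
  rewrite (cvg_lim _ (pr _ tr))// cn_elliptic_integral// -/C.
  by field.
Unshelve. all: by end_near. Qed.

Lemma poly_eq_sqr_itv (f g : {poly R}) :
  (forall k, 0 < k < 1 -> f.[k ^+ 2] = g.[k ^+ 2]) -> f = g.
Proof.
move=> fg; apply/eqP; rewrite -subr_eq0; apply/negP => /negP fg0.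
(* The numbers 1 / (i + 2) lie in ]0, 1[ and have distinct squares; as many as the size of f - g are
   too many roots for a nonzero polynomial. *)
pose s := [seq ((i.+2%:R : R)^-1) ^+ 2 | i <- iota 0 (size (f - g))].
have := @max_poly_roots _ _ s fg0; rewrite size_map size_iota ltnn.
suff [-> ->] : all (root (f - g)) s /\ uniq s by move=> /(_ isT isT).
split.
  apply/allP => x /mapP[i _ ->]; rewrite /root hornerD hornerN fg ?subrr//.
  by rewrite invr_gt0 ltr0n/= invf_lt1// ltr1n.
rewrite map_inj_uniq ?iota_uniq// => i j /eqP.
by rewrite eqrXn2// => /eqP/invr_inj/eqP; rewrite eqr_nat => /eqP[].
Qed.

End Coefficients.

Theorem theorem6 (R : realType) (J : nat -> {poly R})
    (hJ : cn_taylor_polynomials J) (n : nat) :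
  bi_gamma_positive (J n) /\
  alternatingly_increasing (J n) /\
  unimodal (J n).
Proof.
case: hJ => J0 hJ.
suff [? ? ?] : [/\ bi_gamma_positive (J n), alternatingly_increasing (J n) &
  unimodal (J n)] by [].
case: n => [|n]; first by rewrite J0; exact: bi_gamma_positive1.
apply: (@bi_gamma_positive_decomposition _ _ n); last exact: apart_at0.
apply: poly_eq_sqr_itv => k k01.
pose a m := (- 1) ^+ m * (J m).[k ^+ 2] / ((2 * m)`!)%:R.
have ak : \forall u \near (0 : R),
    series (fun m => a m * u ^+ (2 * m)) @ \oo --> cn k u.
  apply: filterS (hJ k k01) => u.
  have -> // : (fun m => a m * u ^+ (2 * m)) = (fun m =>
      (- 1) ^+ m * (J m).[k ^+ 2] * (u ^+ (2 * m) / ((2 * m)`!)%:R)).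
  by apply/funext => m; rewrite /a mulrAC -mulrA.
have := cn_taylor_coef k01 ak n.+1.
rewrite /a mulrC divfK ?pnatr_eq0 -?lt0n ?fact_gt0//.
(* The first derivation of Q gives x S P, and the constant x passes through the remaining ones; it
   is the factor X in front of b. *)
have -> : iter (2 * n.+1) derivation tQ =
    tX (iter (2 * n.+1).-1 derivation (tmul tS tP)).
  by rewrite -iter_derivation_tX -[tX _]/(derivation tQ) -iterSr prednK//; lia.
rewrite /apart /bpart hornerD !hornerM hornerX !horner_exp !hornerN.
rewrite !hornerC !interp_eval0.
move: (iter _ _ (tmul tS tP)) (iter _ _ tP) => e1 e2 /= E.
rewrite -[LHS](signrMK n.+1) E exprS; ring.
Qed.
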